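(* Let $q>p>1$ be reals, $C\in(0,1)$, and $k$ a positive integer with $\frac{1}{k^{p-1}}\leq C$. Consider all vectors $\vec w=(w_1,\dots,w_k)$ with $w_i\geq 0$ for all $i\in[k]$, $\sum_{i=1}^k w_i=1$ and $\sum_{i=1}^k w_i^p=C$. Then the minimum of $\sum_{i=1}^k w_i^q$ over all such vectors equals $f_{p,q}(C)$, and it is attained by a vector with $w_1=w_2=\cdots=w_m>w_{m+1}\geq 0$ and $w_i=0$ for all $i\geq m+2$, for some $m$.
   Context: For reals $q>p>1$, the function $f_{p,q}:[0,1]\to[0,1]$ is defined by $f_{p,q}(0)=0$ and, for every $z\in(0,1]$, $$f_{p,q}\big(\lfloor z^{-1}\rfloor z^p+(1-\lfloor z^{-1}\rfloor z)^p\big)=\lfloor z^{-1}\rfloor z^q+(1-\lfloor z^{-1}\rfloor z)^q;$$ this is well defined since $z\mapsto \lfloor z^{-1}\rfloor z^p+(1-\lfloor z^{-1}\rfloor z)^p$ is a strictly increasing continuous bijection from $(0,1]$ onto $(0,1]$. *)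

(* Defs.v *)
From HB Require Import structures.
From mathcomp Require Import all_boot all_order all_algebra.
From mathcomp Require Import all_classical all_reals all_analysis.
From mathcomp Require Import ring lra.

Set Implicit Arguments.
Unset Strict Implicit.
Unset Printing Implicit Defensive.

Import Order.TTheory GRing.Theory Num.Theory.
Import numFieldNormedType.Exports.

Local Open Scope classical_set_scope.
Local Open Scope ring_scope.

Section Defs.
Variable R : realType.
Implicit Types p q r x z C : R.

(* floor(1/z) z^r + (1 - floor(1/z) z)^r.  For r > 0, powR satisfies
   0 `^ r = 0, as needed when 1/z is an integer. *)
Definition block_sum r z : R :=
  let m := (Num.floor z^-1)%:~R in m * z `^ r + (1 - m * z) `^ r.

(* The value at x <> 0 is read off at a z in (0, 1] with block_sum p z = x;
   fpq_block_sum below shows that the choice of z is immaterial.  Only the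
   restriction to [0, 1] is meaningful. *)
Definition fpq p q x : R :=
  if x == 0 then 0
  else block_sum q (xget 0 [set z | 0 < z <= 1 /\ block_sum p z = x]).

Definition feasible k p C : set 'rV[R]_k :=
  [set w | [/\ forall i, 0 <= w 0 i,
               \sum_(i < k) w 0 i = 1 &
               \sum_(i < k) w 0 i `^ p = C]].

(* w_1 = ... = w_m > w_(m+1) and w_i = 0 for i >= m + 2, with 1 <= m <= k; the
   indices are shifted by one because 'I_k starts at 0.  For m = k there is no
   w_(m+1), and only w_1 = ... = w_k is required. *)
Definition block_shape k m (w : 'rV[R]_k) : Prop :=
  [/\ (0 < m <= k)%N,
      forall i j : 'I_k, (i < m)%N -> (j < m)%N -> w 0 i = w 0 j,
      forall i j : 'I_k, (i < m)%N -> j = m :> nat -> w 0 j < w 0 i &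
      forall i : 'I_k, (m < i)%N -> w 0 i = 0].

Lemma fpq0 p q : fpq p q 0 = 0.
Proof. by rewrite /fpq eqxx. Qed.

Let piece r (n z : R) := n * z `^ r + (1 - n * z) `^ r.

Let piece_le r (n : R) z : 1 < r -> 0 < z -> 0 <= 1 - n * z <= z ->
  piece r n z <= z `^ (r - 1).
Proof.
move=> r1 z0 /andP[t0 tz].
have r0 : 0 < r by lra.
rewrite /piece -(mulr_powRB1 (ltW z0) r0) -(mulr_powRB1 t0 r0).
have h : (1 - n * z) `^ (r - 1) <= z `^ (r - 1).
  by apply: ge0_ler_powR => //; rewrite ?nnegrE; lra.
have := ler_wpM2l t0 h; lra.
Qed.

Let piece_lt r (n : R) z z' : 1 < r -> 0 < n -> (n + 1)^-1 <= z -> z < z' ->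
  n * z' <= 1 -> piece r n z < piece r n z'.
Proof.
move=> r1 n0 nz zz' nz'1.
have r0 : 0 < r by lra.
have z0 : 0 < z by apply: lt_le_trans nz; rewrite invr_gt0; lra.
have nz1 : 1 <= n * z + z.
  by move: nz; rewrite -[(n + 1)^-1]mul1r ler_pdivrMr; [lra|lra].
have nlt : n * z < n * z' by rewrite ltr_pM2l.
have [e|ne] := eqVneq (n * z') 1.
  have -> : piece r n z' = z' `^ (r - 1).
    rewrite /piece e subrr powR0 ?gt_eqF// addr0.
    by rewrite -(mulr_powRB1 (ltW (lt_trans z0 zz')) r0) mulrA e mul1r.
  apply: (@le_lt_trans _ _ (z `^ (r - 1))).
    by apply: piece_le => //; apply/andP; split; lra.
  by apply: gt0_ltr_powR; rewrite ?nnegrE; lra.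
have nz'lt : n * z' < 1 by rewrite lt_neqAle ne.
have D x : x \in `[z, z'] -> is_derive x 1 (piece r n)
    (n * (r * x `^ (r - 1)) - n * (r * (1 - n * x) `^ (r - 1))).
  rewrite in_itv/= => /andP[zx xz'].
  have x0 : 0 < x by lra.
  have nx : 0 < 1 - n * x.
    have : n * x <= n * z' by rewrite ler_pM2l.
    lra.
  have d1 := is_derive1_powR r x0.
  have d2 := is_derive1_powR r nx.
  have d3 : is_derive x 1 (fun y => 1 - n * y) (- n).
    apply: is_derive_eq; rewrite /GRing.scale/=; ring.
  have d4 : is_derive x 1 (fun y => (1 - n * y) `^ r)
     (r * (1 - n * x) `^ (r - 1) * - n).
    change (is_derive x 1 ((@powR R ^~ r) \o (fun y : R => 1 - n * y))
      (r * (1 - n * x) `^ (r - 1) * - n)).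
    exact: is_derive1_comp.
  rewrite /piece.
  apply: is_derive_eq; rewrite /GRing.scale/=; ring.
apply: (@gtr0_derive1_incr _ (piece r n) z z') => //.
- by move=> x /subset_itv_oo_cc /D [].
- move=> x xI; have dx := D x (subset_itv_oo_cc xI).
  rewrite derive1E (@derive_val _ _ _ _ _ _ _ dx) subr_gt0.
  move: xI; rewrite in_itv/= => /andP[zx xz'].
  have : n * z < n * x by rewrite ltr_pM2l.
  have : n * x < n * z' by rewrite ltr_pM2l.
  move=> h1 h2.
  rewrite ltr_pM2l// ltr_pM2l//.
  by apply: gt0_ltr_powR; rewrite ?nnegrE; lra.
- apply: derivable_within_continuous => x xI; by have [] := D x xI.
Qed.

Lemma block_sum_mono p z z' : 1 < p -> 0 < z -> z < z' -> z' <= 1 ->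
  block_sum p z < block_sum p z'.
Proof.
move=> p1 z0 zz' z'1.
have z'0 : 0 < z' by lra.
have itv y : 0 < y -> y <= 1 -> let n := (Num.floor y^-1)%:~R : R in
    [/\ 1 <= n, n * y <= 1, 1 < n * y + y & (n + 1)^-1 < y].
  move=> y0 y1 n.
  have n1 : 1 <= n.
    by rewrite /n -[1]/(1%:~R) ler_int -gtz0_ge1 floor_gt0 invf_ge1.
  have h1 : n * y <= 1.
    by rewrite -ler_pdivlMr// mul1r /n floor_le.
  have h2 : 1 < (n + 1) * y.
    by rewrite -ltr_pdivrMr// mul1r; have := floorD1_gt y^-1; rewrite intrD.
  split => //; first by lra.
  by rewrite -[(n + 1)^-1]mul1r ltr_pdivrMr; [lra|lra].
have [n1 nz1 nz2 nz3] := itv z z0 (ltW (lt_le_trans zz' z'1)).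
have [n'1 nz1' nz2' nz3'] := itv z' z'0 z'1.
rewrite /block_sum -/(piece _ _ _) -/(piece _ _ _).
have : Num.floor z'^-1 <= Num.floor z^-1.
  by apply: le_floor; rewrite lef_pV2 ?posrE// ltW.
rewrite le_eqVlt => /predU1P[e|lt_n].
  by move: nz1'; rewrite e => nz1'; apply: piece_lt => //; [lra|exact: ltW].
set n := (Num.floor z^-1)%:~R in n1 nz1 nz2 nz3 *.
set n' := (Num.floor z'^-1)%:~R in n'1 nz1' nz2' nz3' *.
have nn' : n' + 1 <= n by rewrite /n /n' -[1]/(1%:~R) -intrD ler_int lezD1.
set a := (n' + 1)^-1 in nz3'.
have a0 : 0 < a by rewrite invr_gt0; lra.
have ea : 1 = n' * a + a by rewrite /a; field; lra.
have za : z <= a.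
  rewrite -[a]mul1r ler_pdivlMr; last by lra.
  have : (n' + 1) * z <= n * z by rewrite ler_pM2r.
  lra.
apply: (@le_lt_trans _ _ (z `^ (p - 1))).
  by apply: piece_le => //; apply/andP; split; lra.
apply: (@le_lt_trans _ _ (a `^ (p - 1))).
  by apply: ge0_ler_powR; rewrite ?nnegrE; lra.
apply: (@le_lt_trans _ _ (piece p n' a)); last by apply: piece_lt => //; lra.
rewrite /piece; have -> : 1 - n' * a = a by lra.
have p0 : 0 < p by lra.
rewrite -(mulr_powRB1 (ltW a0) p0) mulrA -mulrDl -ea mul1r; exact: lexx.
Qed.

Lemma fpq_block_sum p q z : 1 < p -> 0 < z <= 1 ->
  fpq p q (block_sum p z) = block_sum q z.
Proof.
move=> p1 /andP[z0 z1].
have bs0 : 0 < block_sum p z.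
  rewrite /block_sum ltr_pwDl ?powR_ge0// mulr_gt0 ?powR_gt0//.
  by rewrite ltr0z floor_gt0 invf_ge1.
rewrite /fpq gt_eqF//; congr block_sum.
case: xgetP => [y _ [/andP[y0 y1] e]|/(_ z)/=]; last first.
  by case; rewrite z0 z1.
by case: (ltgtP y z) => // h; [have := block_sum_mono p1 y0 h z1
  | have := block_sum_mono p1 z0 h y1]; rewrite e ltxx.
Qed.

End Defs.

(* Main.v *)
Require Import Defs.
From HB Require Import structures.
From mathcomp Require Import all_boot all_order all_algebra.
From mathcomp Require Import all_classical all_reals all_analysis.
From mathcomp Require Import ring lra.

Set Implicit Arguments.
Unset Strict Implicit.
Unset Printing Implicit Defensive.

Import Order.TTheory GRing.Theory Num.Theory.
Import numFieldNormedType.Exports.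

Local Open Scope classical_set_scope.
Local Open Scope ring_scope.

(** Compare a feasible vector, sorted decreasingly and padded with zeros, to the
    block vector [(z, ..., z, t, 0, ..., 0)] with [m] entries [z] and the same
    sum and sum of p-th powers.  Because counting functions take integer values,
    the difference of the two counting functions [x |-> #{i : w i > x}] changes
    sign at most twice, at some [xi] and then at [z].  As [u^((q-1)/(p-1))] is
    convex, some combination [x^(q-1) - a x^(p-1) - b] vanishes exactly at [xi]
    and [z] and has the same sign pattern +, -, +.  Its primitive (up to
    a positive factor, [potential] below) therefore has a sum over the
    entries that is no larger for the block vector than for the given one, and
    the terms in [x^p] and [x] cancel by the two constraints. *)

(** * Convexity and continuity of real powers *)

Section PowR.
Variable R : realType.
Implicit Types (a b c r x y z u : R).

Lemma powR_chord c x y z : 1 <= c -> 0 <= x -> x <= y -> y <= z ->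
  (z - x) * y `^ c <= (z - y) * x `^ c + (y - x) * z `^ c.
Proof.
move=> c1 x0 xy yz.
have [xz|zx] := ltP x z; last first.
  have -> : x = y by lra.
  have -> : z = y by lra.
  lra.
pose s := (z - y) / (z - x).
have zx0 : 0 < z - x by lra.
have s0 : 0 <= s by rewrite divr_ge0; lra.
have s1 : s <= 1 by rewrite ler_pdivrMr; lra.
have es : s * (z - x) = z - y by rewrite divfK; lra.
have z0 : 0 <= z by lra.
have := @convex_powR R c c1 (Itv01 s0 s1) x z.
rewrite !inE /= !in_itv /= !andbT => /(_ x0 z0).
rewrite convRE [X in X `^ _ <= _]convRE /= /unstable.onem => h.
have e : s * x + (1 - s) * z = y by lra.
rewrite e in h.
have := ler_wpM2l (ltW zx0) h.
have -> : (z - x) * (s * x `^ c + (1 - s) * z `^ c) =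
  s * (z - x) * x `^ c + ((z - x) - s * (z - x)) * z `^ c by ring.
rewrite es; lra.
Qed.

Lemma within_continuous_powR r b : 0 < r ->
  {within `[0, b], continuous (@powR R ^~ r)}.
Proof.
move=> r0.
have cont x : 0 < x -> {for x, continuous (@powR R ^~ r)}.
  move=> x0; apply: differentiable_continuous; apply/derivable1_diffP.
  by have [] := is_derive1_powR r x0.
have [b0|b0] := ltP 0 b; last first.
  apply: (@continuous_subspaceW _ _ _ [set 0]); last exact: continuous_subspace1.
  by move=> x /=; rewrite in_itv /= => /andP[? ?]; lra.
apply/continuous_within_itvP => //; split.
- by move=> x; rewrite in_itv /= => /andP[x0 _]; exact: cont.
- by rewrite powR0 ?gt_eqF//; exact: powR_cvg0.
- by apply: cvg_at_left_filter; exact: cont.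
Qed.

(** * The potential: increasing, decreasing, increasing *)

Section Potential.
Variables p q xi z : R.
Hypotheses (p1 : 1 < p) (pq : p < q) (xi0 : 0 <= xi) (xiz : xi < z).

Let q1 : 1 < q. Proof. exact: lt_trans pq. Qed.
Let p0 : 0 < p. Proof. exact: lt_trans p1. Qed.
Let q0 : 0 < q. Proof. exact: lt_trans q1. Qed.
Let p10 : 0 < p - 1. Proof. by rewrite subr_gt0. Qed.
Let q10 : 0 < q - 1. Proof. by rewrite subr_gt0. Qed.
Let z0 : 0 < z. Proof. exact: le_lt_trans xiz. Qed.

(* [Q / P] is the coefficient [a]; scaling by [P] avoids the division. *)
Let P := z `^ (p - 1) - xi `^ (p - 1).
Let Q := z `^ (q - 1) - xi `^ (q - 1).

Definition potential x : R :=
  P / q * x `^ q - Q / p * x `^ p -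
  (P * xi `^ (q - 1) - Q * xi `^ (p - 1)) * x.

(** The derivative of [potential], arranged so that its zeros at [xi] and [z] are visible. *)
Let potential' x : R :=
  P * (x `^ (q - 1) - xi `^ (q - 1)) - Q * (x `^ (p - 1) - xi `^ (p - 1)).

(** In the variable [u = x^(p-1)], [x^(q-1)] is [u^((q-1)/(p-1))], with exponent at least 1. Applied
    to [xi], [z] and a third point in each of the three possible orders, this gives the sign of
    [potential']. *)
Let chord x y w : 0 <= x -> x <= y -> y <= w ->
  (w `^ (p - 1) - x `^ (p - 1)) * y `^ (q - 1) <=
  (w `^ (p - 1) - y `^ (p - 1)) * x `^ (q - 1) +
  (y `^ (p - 1) - x `^ (p - 1)) * w `^ (q - 1).
Proof.
move=> x0 xy yw.
have powE u : u `^ (q - 1) = (u `^ (p - 1)) `^ ((q - 1) / (p - 1)).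
  by rewrite -powRrM mulrC divfK ?gt_eqF.
rewrite !powE; apply: powR_chord.
- by rewrite ler_pdivlMr// mul1r lerD2r ltW.
- exact: powR_ge0.
- by apply: ge0_ler_powR; rewrite ?nnegrE ?(ltW p10)//; lra.
- by apply: ge0_ler_powR; rewrite ?nnegrE ?(ltW p10)//; lra.
Qed.

Let is_derive_potential x : 0 < x -> is_derive x 1 potential (potential' x).
Proof.
move=> x0.
have dq := is_derive1_powR q x0.
have dp := is_derive1_powR p x0.
rewrite /potential /potential'.
apply: is_derive_eq; rewrite /GRing.scale/=; field.
by rewrite !gt_eqF.
Qed.

Let continuous_potential a b : 0 <= a ->
  {within `[a, b], continuous potential}.
Proof.
move=> a0.
apply: (@continuous_subspaceW _ _ _ `[0, b]).
  by move=> x /=; rewrite !in_itv /= => /andP[? ->]; rewrite andbT; lra.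
have cq : {within `[0, b], continuous (@powR R ^~ q)}.
  exact: within_continuous_powR.
have cp : {within `[0, b], continuous (@powR R ^~ p)}.
  exact: within_continuous_powR.
move=> x; apply: cvgB; first apply: cvgB.
- by apply: cvgM; [exact: cvg_cst|exact: cq].
- by apply: cvgM; [exact: cvg_cst|exact: cp].
- apply: cvgM; first exact: cvg_cst.
  by move: x; apply: continuous_subspaceT => x; exact: cvg_id.
Qed.

Let potential_ndecr a b : 0 <= a ->
  (forall x, a < x -> x < b -> 0 <= potential' x) ->
  forall x y, a <= x -> x <= y -> y <= b -> potential x <= potential y.
Proof.
move=> a0 h; apply: ger0_derive1_ndecr; last exact: continuous_potential.
- move=> x; rewrite in_itv /= => /andP[ax xb].
  by have [] := is_derive_potential (le_lt_trans a0 ax).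
- move=> x; rewrite in_itv /= => /andP[ax xb].
  have dx := is_derive_potential (le_lt_trans a0 ax).
  by rewrite derive1E (@derive_val _ _ _ _ _ _ _ dx); exact: h.
Qed.

Lemma potential_ndecr_left x y : 0 <= x -> x <= y -> y <= xi ->
  potential x <= potential y.
Proof.
apply: potential_ndecr => // u u0 uxi.
have := chord (ltW u0) (ltW uxi) (ltW xiz).
rewrite /potential' /P /Q; lra.
Qed.

Lemma potential_ndecr_right x y : z <= x -> x <= y ->
  potential x <= potential y.
Proof.
move=> zx xy.
apply: (@potential_ndecr z y) => //; first exact: ltW.
move=> u zu _; have := chord xi0 (ltW xiz) (ltW zu).
rewrite /potential' /P /Q; lra.
Qed.

Lemma potential_nincr x y : xi <= x -> x <= y -> y <= z ->
  potential y <= potential x.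
Proof.
apply: ler0_derive1_nincr; last exact: continuous_potential.
- move=> u; rewrite in_itv /= => /andP[xu _].
  by have [] := is_derive_potential (le_lt_trans xi0 xu).
- move=> u; rewrite in_itv /= => /andP[xu uz].
  have du := is_derive_potential (le_lt_trans xi0 xu).
  rewrite derive1E (@derive_val _ _ _ _ _ _ _ du).
  have := chord xi0 (ltW xu) (ltW uz).
  rewrite /potential' /P /Q; lra.
Qed.

Lemma potential0 : potential 0 = 0.
Proof. by rewrite /potential !powR0 ?gt_eqF ?mulr0 ?subr0. Qed.

Lemma potential_min x : xi <= x -> potential z <= potential x.
Proof.
by move=> ?; have [?|?] := leP x z;
  [exact: potential_nincr | apply: potential_ndecr_right => //; exact: ltW].
Qed.

Lemma potential_max x : 0 <= x -> x <= z -> potential x <= potential xi.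
Proof.
by move=> ? ?; have [?|?] := leP x xi;
  [exact: potential_ndecr_left | apply: potential_nincr => //; exact: ltW].
Qed.

Lemma potential_ge0 x : 0 <= x -> x <= xi -> 0 <= potential x.
Proof. by move=> ? ?; rewrite -potential0; exact: potential_ndecr_left. Qed.

(** The linear and p-th power parts agree on both sides, and the coefficient [P / q] of what remains
    is positive. *)
Lemma le_powR_sum_of_potential (I J : Type) (r : seq I) (s : seq J)
    (f : I -> R) (g : J -> R) :
  \sum_(i <- r) f i = \sum_(j <- s) g j ->
  \sum_(i <- r) f i `^ p = \sum_(j <- s) g j `^ p ->
  \sum_(i <- r) potential (f i) <= \sum_(j <- s) potential (g j) ->
  \sum_(i <- r) f i `^ q <= \sum_(j <- s) g j `^ q.
Proof.
have sumE (K : Type) (l : seq K) (h : K -> R) : \sum_(i <- l) potential (h i) =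
    P / q * \sum_(i <- l) h i `^ q - Q / p * \sum_(i <- l) h i `^ p -
    (P * xi `^ (q - 1) - Q * xi `^ (p - 1)) * \sum_(i <- l) h i.
  by rewrite !mulr_sumr -!sumrB.
rewrite !sumE => -> ->; rewrite !lerD2r ler_pM2l// divr_gt0//.
by rewrite subr_gt0; apply: gt0_ltr_powR; rewrite ?nnegrE// ltW.
Qed.

End Potential.
End PowR.

(** * Block vectors and their optimality *)

Section Blocks.
Variable R : realType.
Implicit Types (p q r z t C : R) (m k : nat).

Definition block m z t (i : nat) : R :=
  if (i < m)%N then z else if i == m then t else 0.

(** For [m = k] the entry [t] lies outside the range of summation, so it has to be 0. *)
Lemma sum_block (F : R -> R) m k z t : F 0 = 0 -> (m <= k)%N ->
  (m = k -> t = 0) ->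
  \sum_(i < k) F (block m z t i) = m%:R * F z + F t.
Proof.
move=> F0 mk; rewrite -(subnKC mk); move: (k - m)%N => d tE.
rewrite big_split_ord /=; congr (_ + _).
  rewrite (eq_bigr (fun=> F z)); last by move=> i _; rewrite /block ltn_ord.
  by rewrite sumr_const card_ord mulr_natl.
case: d => [|d] in tE *.
  by rewrite big_ord0 tE ?addn0.
rewrite big_ord_recl /= /block addn0 ltnn eqxx big1 ?addr0// => i _.
by rewrite /bump /= ltnNge leq_addr /= -[X in _ == X]addn0 eqn_add2l.
Qed.

(** The sorted values, continued by the default 0 of [nth]. The continuation keeps [v m] meaningful
    when [m = k], and [F 0 = 0] makes it invisible in sums. *)
Lemma nonincreasing_rearrangement k (w : 'I_k -> R) : (forall i, 0 <= w i) ->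
  exists v : nat -> R, [/\ forall i, 0 <= v i,
    forall i j, (i <= j)%N -> v j <= v i &
    forall (F : R -> R) (K : nat), F 0 = 0 -> (k <= K)%N ->
      \sum_(i < K) F (v i) = \sum_(i < k) F (w i)].
Proof.
move=> w0; pose s := sort >=%R [seq w i | i <- enum 'I_k].
have szs : size s = k.
  by rewrite size_sort size_map size_enum_ord.
have v0 i : 0 <= nth 0 s i.
  have [ik|ik] := ltnP i (size s); last by rewrite nth_default.
  have := mem_nth 0 ik; rewrite mem_sort => /mapP[j _ ->]; exact: w0.
exists (nth 0 s); split => //.
- move=> i j ij; have [js|js] := ltnP j (size s); last first.
    by rewrite [nth 0 s j]nth_default.
  apply: (@sorted_leq_nth _ >=%R) => //.
  + by move=> a b c /= h1 h2; exact: le_trans h2 h1.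
  + by move=> a /=.
  + by apply: sort_sorted => a b; exact: le_total.
  + by rewrite inE; exact: leq_ltn_trans js.
- move=> F K F0 kK.
  rewrite -(subnKC kK) big_split_ord /= [X in _ + X]big1 ?addr0; last first.
    by move=> i _; rewrite nth_default ?szs ?leq_addr.
  rewrite -[in LHS]szs -(big_mkord predT (fun i => F (nth 0 s i))).
  rewrite -(big_nth 0 predT F) (perm_big _ (permEl (perm_sort _ _))).
  by rewrite big_map big_enum.
Qed.

(* The node [xi] of the potential is where the counting function
   [#{i : w i > x}] drops below that of the block vector: at [w m] if
   [w m < t], and at [w m.-1] otherwise. *)
Lemma block_optimal p q (w : nat -> R) m k z t : 1 < p -> p < q ->
  (0 < m)%N -> 0 <= t -> t < z ->
  (forall i, 0 <= w i) -> (forall i j, (i <= j)%N -> w j <= w i) ->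
  \sum_(i < k) block m z t i = \sum_(i < k) w i ->
  \sum_(i < k) block m z t i `^ p = \sum_(i < k) w i `^ p ->
  \sum_(i < k) block m z t i `^ q <= \sum_(i < k) w i `^ q.
Proof.
move=> p1 pq m0 t0 tz w0 wle S1 Sp.
have termwise (F : R -> R) : F 0 = 0 ->
    (forall i, (i < m)%N -> F z <= F (w i)) ->
    F t <= F (w m) -> (forall i, (m < i)%N -> 0 <= F (w i)) ->
    \sum_(i < k) F (block m z t i) <= \sum_(i < k) F (w i).
  move=> F0 Fz Ft Fr; apply: ler_sum => i _; rewrite /block.
  case: (ltngtP i m) => [im|mi|->//]; [exact: Fz|by rewrite F0; exact: Fr].
have [wt|tw] := ltP (w m) t.
  have xz : w m < z by lra.
  apply: (le_powR_sum_of_potential p1 pq (w0 m) xz S1 Sp).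
  apply: termwise.
  - exact: potential0.
  - by move=> i im; apply: potential_min => //; apply: wle; exact: ltnW.
  - by apply: potential_max => //; exact: ltW.
  - by move=> i im; apply: potential_ge0 => //; apply: wle; exact: ltnW.
have [zw|wz] := leP z (w m.-1).
  have wz i : (i < m)%N -> z <= w i.
    by move=> im; apply: le_trans zw _; apply: wle; rewrite -ltnS prednK.
  apply: (termwise (@powR R ^~ q)).
  - by rewrite powR0// gt_eqF//; lra.
  - by move=> i /wz h; apply: ge0_ler_powR; rewrite ?nnegrE//; lra.
  - by apply: ge0_ler_powR; rewrite ?nnegrE//; lra.
  - by move=> i _; exact: powR_ge0.
have wm : w m <= w m.-1 by apply: wle; exact: leq_pred.
apply: (le_powR_sum_of_potential p1 pq (w0 m.-1) wz S1 Sp).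
apply: termwise.
- exact: potential0.
- move=> i im; apply: potential_min => //; apply: wle.
  by rewrite -ltnS prednK.
- exact: potential_ndecr_left.
- move=> i im; apply: potential_ge0 => //; apply: wle.
  by rewrite (leq_trans (leq_pred m))// ltnW.
Qed.

(** * Existence, uniqueness of shape and size of the block vector *)

(** As [x^r = x * x^(r-1)], the left side combines [z^(r-1)] and the smaller [t^(r-1)] with weights
    [n * z] and [t] of sum 1. *)
Lemma block_powR_le r (n z t : R) : 1 < r -> 0 < z -> 0 <= t -> t <= z ->
  n * z + t = 1 -> n * z `^ r + t `^ r <= z `^ (r - 1).
Proof.
move=> r1 z0 t0 tz e.
have r0 : 0 < r by lra.
rewrite -(mulr_powRB1 (ltW z0) r0) -(mulr_powRB1 t0 r0).
have h : t `^ (r - 1) <= z `^ (r - 1).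
  by apply: ge0_ler_powR; rewrite ?nnegrE//; lra.
have := ler_wpM2l t0 h.
have -> : n * (z * z `^ (r - 1)) = (1 - t) * z `^ (r - 1).
  by rewrite mulrA; congr (_ * _); lra.
lra.
Qed.

(** The bounds on [t] say that [m <= 1/z < m + 1], so [block_sum] at [z] uses exactly this [m] and
    this [t]. *)
Lemma floor_inv_block m z t : (0 < m)%N -> 0 <= t -> t < z ->
  m%:R * z + t = 1 -> Num.floor z^-1 = m%:Z.
Proof.
move=> m0 t0 tz e; have z0 : 0 < z by lra.
apply: floor_def; rewrite intrD -[1%:~R]/(1 : R) -pmulrn -[z^-1]mul1r.
by rewrite ler_pdivlMr// ltr_pdivrMr//; apply/andP; split; lra.
Qed.

Lemma block_sumE r m z t : (0 < m)%N -> 0 <= t -> t < z ->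
  m%:R * z + t = 1 -> block_sum r z = m%:R * z `^ r + t `^ r.
Proof.
move=> m0 t0 tz e; rewrite /block_sum (floor_inv_block m0 t0 tz e).
by rewrite -pmulrn (_ : 1 - m%:R * z = t)//; lra.
Qed.

(** Intermediate values in [t] for a fixed [m]: from [m] equal entries at [t = 0], with power sum
    [(1/m)^(p-1) >= C], to [m + 1] equal entries at [t = b], with power sum [b^(p-1) < C]. The
    choice of [m] as the floor of [1/y], where [y^(p-1) = C], gives both bounds. *)
Lemma exists_block p C : 1 < p -> 0 < C -> C < 1 ->
  exists m z t, [/\ (0 < m)%N, 0 <= t, t < z, m%:R * z + t = 1 &
    m%:R * z `^ p + t `^ p = C].
Proof.
move=> p1 C0 C1.
pose y := C `^ (p - 1)^-1.
have y0 : 0 < y by exact: powR_gt0.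
have yC : y `^ (p - 1) = C by rewrite /y -powRrM mulVf ?powRr1 ?ltW//; lra.
have y1 : y < 1.
  rewrite ltNge; apply/negP => y1.
  have : 1 `^ (p - 1) <= y `^ (p - 1).
    by apply: ge0_ler_powR; rewrite ?nnegrE//; lra.
  by rewrite yC powR1; lra.
have fl0 : (0 < Num.floor y^-1)%R by rewrite floor_gt0 invf_ge1// ltW.
pose m := `|Num.floor y^-1|%N.
have mE : (Num.floor y^-1)%:~R = m%:R :> R.
  by rewrite /m -[in LHS](gtz0_abs fl0).
have m0 : (0 < m)%N by rewrite absz_gt0 gt_eqF.
have m0R : 0 < m%:R :> R by rewrite ltr0n.
have my : m%:R * y <= 1 by rewrite -ler_pdivlMr// mul1r -mE floor_le.
have my1 : 1 < (m%:R + 1) * y.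
  by rewrite -ltr_pdivrMr// mul1r; have := floorD1_gt y^-1; rewrite intrD mE.
pose b : R := (m%:R + 1)^-1.
have b0 : 0 < b by rewrite invr_gt0; lra.
have be : m%:R * b + b = 1 by rewrite /b; field; lra.
have b_lt_y : b < y.
  have : (m%:R + 1) * b < (m%:R + 1) * y by lra.
  by rewrite ltr_pM2l//; lra.
pose zt (t : R) := (1 - t) / m%:R.
have ztE t : m%:R * zt t + t = 1 by rewrite /zt; field; lra.
have zt_gt0 t : t <= b -> 0 < zt t.
  by move=> tb; have := ztE t; rewrite -(pmulr_rgt0 _ m0R); nra.
pose f (t : R) := m%:R * zt t `^ p + t `^ p.
have p0 : 0 < p by lra.
have f0 : C <= f 0.
  rewrite /f powR0 ?gt_eqF// addr0 -(mulr_powRB1 (ltW (zt_gt0 _ (ltW b0))) p0).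
  rewrite mulrA (_ : m%:R * zt 0 = 1) ?mul1r; last by have := ztE 0; lra.
  rewrite -yC; apply: ge0_ler_powR; rewrite ?nnegrE//; [lra|lra| |].
    by apply/ltW/zt_gt0/ltW.
  by rewrite /zt ler_pdivlMr//; lra.
have fb : f b < C.
  have ztb : zt b = b.
    by apply: (mulfI (lt0r_neq0 m0R)); have := ztE b; lra.
  rewrite /f ztb -(mulr_powRB1 (ltW b0) p0) mulrA -mulrDl be mul1r -yC.
  by apply: gt0_ltr_powR; rewrite ?nnegrE//; lra.
have fc : {within `[0, b], continuous f}.
  have c1 : {within `[0, b], continuous (fun t => m%:R * zt t `^ p)}.
    apply: derivable_within_continuous => t; rewrite in_itv /= => /andP[_ tb].
    have d1 := is_derive1_powR p (zt_gt0 t tb).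
    have d2 : is_derive t 1 zt (- m%:R^-1).
      by rewrite /zt; apply: is_derive_eq; rewrite /GRing.scale/=; ring.
    have d3 : is_derive t 1 (fun t => zt t `^ p)
        (p * zt t `^ (p - 1) * - m%:R^-1).
      change (is_derive t 1 ((@powR R ^~ p) \o zt)
        (p * zt t `^ (p - 1) * - m%:R^-1)).
      exact: is_derive1_comp.
    by apply: derivableM => //; case: d3.
  by move=> t; apply: cvgD; [exact: c1|exact: within_continuous_powR].
have [|t] := @IVT R f 0 b C (ltW b0) fc.
  rewrite le_max f0 /= andbT.
  by rewrite ge_min (ltW fb) orbT.
rewrite in_itv /= => /andP[t0 tb] ft.
exists m, (zt t), t; split => //.
(* Strictness here is what yields [t < z]. *)
have tb' : t < b.
  by rewrite lt_neqAle tb andbT; apply/eqP => e; move: fb; rewrite -e ft ltxx.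
rewrite -(ltr_pM2l m0R).
have : m%:R * t < m%:R * b by rewrite ltr_pM2l.
have := ztE t; lra.
Qed.

(** The bound [C <= z^(p-1)] and the hypothesis on [k] force [k * z >= 1 = m * z + t]. This excludes
    [m > k], and leaves [t = 0] if [m = k]. *)
Lemma block_size_le p C m k z t : 1 < p -> (0 < m)%N -> (0 < k)%N ->
  0 <= t -> t < z -> m%:R * z + t = 1 -> m%:R * z `^ p + t `^ p = C ->
  1 / k%:R `^ (p - 1) <= C -> (m <= k)%N /\ (m = k -> t = 0).
Proof.
move=> p1 m0 k0 t0 tz e1 eC kC.
have z0 : 0 < z by lra.
have k0R : 0 < k%:R :> R by rewrite ltr0n.
have kz : 1 <= k%:R * z.
  rewrite leNgt; apply/negP => kz1.
  have : (k%:R * z) `^ (p - 1) < 1 `^ (p - 1).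
    by apply: gt0_ltr_powR; rewrite ?nnegrE ?mulr_ge0//; lra.
  rewrite powR1 powRM//; last exact: ltW.
  have := block_powR_le p1 z0 t0 (ltW tz) e1; rewrite eC => Cz.
  move: kC; rewrite ler_pdivrMr ?powR_gt0// => kC lt1.
  have := ler_wpM2r (powR_ge0 k%:R (p - 1)) Cz; lra.
split.
  rewrite leqNgt; apply/negP => km.
  have : k%:R + 1 <= m%:R :> R by rewrite natr1 ler_nat.
  move=> h; have : (k%:R + 1) * z <= m%:R * z by rewrite ler_pM2r.
  lra.
by move=> mk; move: kz; rewrite -mk; lra.
Qed.

End Blocks.

(** * The block vector as minimizer, with value [fpq p q C] *)

Theorem theorem2p1 (R : realType) (p q C : R) (k : nat) :
  1 < p -> p < q -> 0 < C -> C < 1 -> (0 < k)%N ->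
  1 / k%:R `^ (p - 1) <= C ->
  (forall w : 'rV[R]_k, feasible p C w ->
     fpq p q C <= \sum_(i < k) w 0 i `^ q) /\
  (exists w : 'rV[R]_k,
     [/\ feasible p C w,
         \sum_(i < k) w 0 i `^ q = fpq p q C &
         exists m : nat, block_shape m w]).
Proof.
move=> p1 pq C0 C1 k0 kC.
have [m [z [t [m0 t0 tz e1 eC]]]] := exists_block p1 C0 C1.
have z0 : 0 < z by lra.
have z1 : z <= 1.
  have : 1 * z <= m%:R * z by rewrite ler_pM2r// ler1n.
  lra.
(* Both power sums of the block vector are values of [block_sum] at the same [z]. *)
have fE : fpq p q C = m%:R * z `^ q + t `^ q.
  rewrite -eC -(block_sumE p m0 t0 tz e1) -(block_sumE q m0 t0 tz e1).
  by apply: fpq_block_sum; rewrite ?z0.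
have powR00 r : 1 < r -> (0 : R) `^ r = 0.
  by move=> r1; rewrite powR0// gt_eqF//; lra.
have q1 : 1 < q by lra.
have [mk tk] := block_size_le p1 m0 k0 t0 tz e1 eC kC.
rewrite fE; split.
  move=> w [w0 w1 wC].
  have [v [v0 vle vE]] := nonincreasing_rearrangement w0.
  (* Both sides become sums over [k] entries: of the block vector and of the rearrangement [v]. *)
  rewrite -(vE (@powR R ^~ q) k) ?powR00//.
  rewrite -(sum_block (F := @powR R ^~ q) _ (powR00 _ q1) mk tk).
  apply: (block_optimal p1 pq m0 t0 tz v0 vle).
  - by rewrite (sum_block (F := id))// (vE id)//= w1.
  - rewrite (sum_block (F := @powR R ^~ p) _ (powR00 _ p1) mk tk).
    by rewrite (vE (@powR R ^~ p)) ?powR00//= wC.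
exists (\row_i block m z t i); split.
- split.
  + by move=> i; rewrite mxE /block; case: ifP => _; [exact: ltW|case: ifP].
  + under eq_bigr do rewrite mxE.
    by rewrite (sum_block (F := id)).
  + under eq_bigr do rewrite mxE.
    by rewrite (sum_block (F := @powR R ^~ p)) ?powR00.
- under eq_bigr do rewrite mxE.
  by rewrite (sum_block (F := @powR R ^~ q)) ?powR00.
- exists m; split.
  + by rewrite m0 mk.
  + by move=> i j im jm; rewrite !mxE /block im jm.
  + by move=> i j im jm; rewrite !mxE /block im jm ltnn eqxx.
  + by move=> i mi; rewrite mxE /block ltnNge (ltnW mi) gtn_eqF.
Qed.
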